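(* Let positive parameters $\mu_x,\mu_y>0$ and $L_x>\mu_x$, $L_y>\mu_y$, $L_{xy}>0$ be given. Set $B_x=\frac{L_x-\mu_x}{4}$, $B_y=\frac{L_y-\mu_y}{4}$, $$\alpha = \frac{L_{xy}^2}{4B_xB_y} + \frac{\mu_x}{B_x} + \frac{\mu_y}{B_y},\qquad \beta = \frac{\mu_x\mu_y}{B_xB_y},$$ and let $q$ be a real root of the quartic equation $1 -(4+\alpha)x + (6+2\alpha + \beta)x^2 - (4+\alpha)x^3 + x^4 = 0$ satisfying $$1-\left(\tfrac12 +\tfrac{1}{2\sqrt{2}}\sqrt{\tfrac{L_x}{\mu_x} + \tfrac{L_{xy}^2}{\mu_x\mu_y} + \tfrac{L_y}{\mu_y}}\right)^{-1}<q<1 - \left(\tfrac12 +\tfrac{1}{2}\sqrt{\tfrac{L_{xy}^2}{\mu_x\mu_y} + \tfrac{L_x}{\mu_x} + \tfrac{L_y}{\mu_y}-1}\right)^{-1}.$$ For any positive integer $k$, there exists a problem instance in $\mathcal{F}(L_x,L_y,L_{xy},\mu_x,\mu_y)$ of the form $$\min_{x\in\mathbb{R}^n}\max_{y\in\mathbb{R}^n} F(x,y)=\tfrac12 x^\top (B_xA^2 + \mu_xI)x + \tfrac{L_{xy}}{2}x^\top Ay - \tfrac12 y^\top (B_yA^2 + \mu_yI)y - b^\top y,$$ with $n\geq \max\big\{2\log_q\big(\tfrac{7+\alpha}{\beta}\big),\ 2k\big\}$, the matrix $A\in\mathbb{R}^{n\times n}$ as in the context, and $b = \frac{2B_xB_y}{L_{xy}}A^{-1}\hat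 b$ where $\hat b_1=(2+\alpha + \beta)q - (3+\alpha)q^2+q^3$, $\hat b_2=q-1$, $\hat b_i=0$ for $3\le i\le n$, such that, writing $(x^*,y^* )$ for its saddle point, any approximate solution $(\tilde x^k,\tilde y^k)\in\mathcal{H}_x^k\times\mathcal{H}_y^k$ generated by the pure first-order algorithm class (with linear span) started at $x^0=y^0=0$ satisfies $$\max_y F(\tilde x^{k},y) - \min_{x} F(x, \tilde y^k)\geq q^{2k}\cdot\frac{\mu_x\|x^*-x^0\|^2}{32}\quad\text{and}\quad \|\tilde x^k-x^*\|^2\geq q^{2k}\cdot\frac{\|x^*-x^0\|^2}{16}.$$
   Context: Class $\mathcal{F}(L_x,L_y,L_{xy},\mu_x,\mu_y)$: problems $\min_x\max_yF(x,y)$ with $F$ smooth, $F(\cdot,y)$ $\mu_x$-strongly convex for each fixed $y$, $F(x,\cdot)$ $\mu_y$-strongly concave for each fixed $x$, and for all arguments $\|\nabla_xF(x_1,y)-\nabla_xF(x_2,y)\|\le L_x\|x_1-x_2\|$, $\|\nabla_yF(x,y_1)-\nabla_yF(x,y_2)\|\le L_y\|y_1-y_2\|$, $\|\nabla_xF(x,y_1)-\nabla_xF(x,y_2)\|\le L_{xy}\|y_1-y_2\|$, $\|\nabla_yF(x_1,y)-\nabla_yF(x_2,y)\|\le L_{xy}\|x_1-x_2\|$. Pure first-order algorithm class (with linear span): iterates $(x^k,y^k)_{k\ge0}$ are generated so that $(x^k,y^k)\in\mathcal{H}_x^k\times\mathcal{H}_y^k$, with $\mathcal{H}_x^0=\mathrm{Span}\{x^0\}$,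 $\mathcal{H}_y^0=\mathrm{Span}\{y^0\}$ and $$\mathcal{H}_x^{k+1}=\mathrm{Span}\{x^i,\nabla_xF(\tilde x^i,\tilde y^i):\forall\,\tilde x^i\in\mathcal{H}_x^i,\tilde y^i\in\mathcal{H}_y^i,0\le i\le k\},$$ $$\mathcal{H}_y^{k+1}=\mathrm{Span}\{y^i,\nabla_yF(\tilde x^i,\tilde y^i):\forall\,\tilde x^i\in\mathcal{H}_x^i,\tilde y^i\in\mathcal{H}_y^i,0\le i\le k\}.$$ $A\in\mathbb{R}^{n\times n}$ (symmetric, invertible): $A_{i,n+1-i}=1$ for $1\le i\le n$, $A_{i,n+2-i}=-1$ for $2\le i\le n$, other entries $0$. $\log_q$ denotes the logarithm to base $q$, and $\|\cdot\|$ is the Euclidean norm. *)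

(* Defs.v *)
From HB Require Import structures.
From mathcomp Require Import all_boot all_order all_algebra.
From mathcomp Require Import all_classical all_reals all_analysis.

Set Implicit Arguments.
Unset Strict Implicit.
Unset Printing Implicit Defensive.

Import Order.TTheory GRing.Theory Num.Theory.
Import numFieldNormedType.Exports.

Local Open Scope classical_set_scope.
Local Open Scope ring_scope.

(* Euclidean norm: the norm `|x| that the library puts on matrices is the
   max norm. *)
Definition enorm {R : realType} {n : nat} (x : 'cV[R]_n) : R :=
  Num.sqrt (\sum_(i < n) x i 0 ^+ 2).

Definition gradient {R : realType} {n : nat} (f : 'cV[R]_n -> R)
    (x : 'cV[R]_n) : 'cV[R]_n :=
  \col_(i < n) 'D_(delta_mx i 0) f x.

Definition grad_x {R : realType} {n m : nat} (F : 'cV[R]_n -> 'cV[R]_m -> R)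
    (x : 'cV[R]_n) (y : 'cV[R]_m) : 'cV[R]_n :=
  gradient (fun x' => F x' y) x.

Definition grad_y {R : realType} {n m : nat} (F : 'cV[R]_n -> 'cV[R]_m -> R)
    (x : 'cV[R]_n) (y : 'cV[R]_m) : 'cV[R]_m :=
  gradient (fun y' => F x y') y.

(* Smoothness in the sense of first-order optimization: continuously
   differentiable, jointly in (x, y); the Lipschitz constants of the gradient
   are separate conditions of [problem_class]. *)
Definition smooth {R : realType} {n m : nat}
    (F : 'cV[R]_n -> 'cV[R]_m -> R) : Prop :=
  [/\ forall p : 'cV[R]_n * 'cV[R]_m,
        differentiable (fun p : 'cV[R]_n * 'cV[R]_m => F p.1 p.2) p,
      continuous (fun p : 'cV[R]_n * 'cV[R]_m => grad_x F p.1 p.2)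
    & continuous (fun p : 'cV[R]_n * 'cV[R]_m => grad_y F p.1 p.2)].

Definition strongly_convex {R : realType} {n : nat} (mu : R)
    (f : 'cV[R]_n -> R) : Prop :=
  forall (x1 x2 : 'cV[R]_n) (t : R), 0 <= t <= 1 ->
    f (t *: x1 + (1 - t) *: x2) <=
      t * f x1 + (1 - t) * f x2 - mu / 2 * t * (1 - t) * enorm (x1 - x2) ^+ 2.

Definition strongly_concave {R : realType} {n : nat} (mu : R)
    (f : 'cV[R]_n -> R) : Prop :=
  strongly_convex mu (fun x => - f x).

Definition problem_class {R : realType} {n m : nat} (Lx Ly Lxy mux muy : R)
    (F : 'cV[R]_n -> 'cV[R]_m -> R) : Prop :=
  smooth F /\
  (forall y, strongly_convex mux (fun x => F x y)) /\
  (forall x, strongly_concave muy (fun y => F x y)) /\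
  (forall x1 x2 y,
    enorm (grad_x F x1 y - grad_x F x2 y) <= Lx * enorm (x1 - x2)) /\
  (forall x y1 y2,
    enorm (grad_y F x y1 - grad_y F x y2) <= Ly * enorm (y1 - y2)) /\
  (forall x y1 y2,
    enorm (grad_x F x y1 - grad_x F x y2) <= Lxy * enorm (y1 - y2)) /\
  (forall x1 x2 y,
    enorm (grad_y F x1 y - grad_y F x2 y) <= Lxy * enorm (x1 - x2)).

Definition saddle_point {R : realType} {n m : nat}
    (F : 'cV[R]_n -> 'cV[R]_m -> R) (xs : 'cV[R]_n) (ys : 'cV[R]_m) : Prop :=
  forall x y, F xs y <= F xs ys /\ F xs ys <= F x ys.

Definition is_max {R : realType} (S : set R) (M : R) : Prop :=
  S M /\ ubound S M.

Definition is_min {R : realType} (S : set R) (M : R) : Prop :=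
  S M /\ lbound S M.

Definition Span {R : realType} {n : nat} (S : set 'cV[R]_n) : set 'cV[R]_n :=
  [set v | exists (p : nat) (c : 'I_p -> R) (u : 'I_p -> 'cV[R]_n),
    (forall i, S (u i)) /\ v = \sum_(i < p) c i *: u i].

(* [x], [y] are the iterates and [Hx k], [Hy k] the subspaces they generate.
   The first four conditions determine Hx and Hy uniquely from x, y and F, by
   course-of-values recursion on k. *)
Definition pure_first_order_span {R : realType} {n m : nat}
    (F : 'cV[R]_n -> 'cV[R]_m -> R)
    (x : nat -> 'cV[R]_n) (y : nat -> 'cV[R]_m)
    (Hx : nat -> set 'cV[R]_n) (Hy : nat -> set 'cV[R]_m) : Prop :=
  [/\ Hx 0%N = Span [set x 0%N],
      Hy 0%N = Span [set y 0%N],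
      forall k, Hx k.+1 =
        Span [set u | exists2 i : nat, (i <= k)%N &
          u = x i \/
          exists xt yt, [/\ Hx i xt, Hy i yt & u = grad_x F xt yt]],
      forall k, Hy k.+1 =
        Span [set u | exists2 i : nat, (i <= k)%N &
          u = y i \/
          exists xt yt, [/\ Hx i xt, Hy i yt & u = grad_y F xt yt]]
    & forall k, Hx k (x k) /\ Hy k (y k)].

(* Ordinals start at 0, so the 1-based conditions j = n + 1 - i and
   j = n + 2 - i become i + j + 1 = n and i + j = n; the latter already
   excludes the first row. *)
Definition Amx (R : realType) (n : nat) : 'M[R]_n :=
  \matrix_(i < n, j < n)
    (if (i + j).+1 == n then 1 else if (i + j)%N == n then -1 else 0).

Definition bhat {R : realType} (n : nat) (alpha beta q : R) : 'cV[R]_n :=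
  \col_(i < n)
    match nat_of_ord i with
    | 0%N => (2 + alpha + beta) * q - (3 + alpha) * q ^+ 2 + q ^+ 3
    | 1%N => q - 1
    | _ => 0
    end.

Definition qform {R : realType} {n : nat} (M : 'M[R]_n) (u v : 'cV[R]_n) : R :=
  (u^T *m M *m v) 0 0.

Definition hard_instance {R : realType} {n : nat} (Bx By Lxy mux muy : R)
    (b : 'cV[R]_n) (x y : 'cV[R]_n) : R :=
  let A := Amx R n in
  1 / 2 * qform (Bx *: A ^+ 2 + mux *: 1%:M) x x
  + Lxy / 2 * qform A x y
  - 1 / 2 * qform (By *: A ^+ 2 + muy *: 1%:M) y y
  - (b^T *m y) 0 0.

Definition log_base {R : realType} (q x : R) : R := ln x / ln q.

(* Main.v *)
(* Eliminating y from the stationarity equations leaves the linear system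
   (A^4 + alpha A^2 + beta I) x = bhat, where A^2 is a discrete Laplacian on a
   path.  The quartic for q says precisely that x_i = q^i solves all rows but
   the last two, whose residual is O(q^n); since the matrix is at least beta I,
   the minimizer x* is O(q^n)-close to that geometric vector, so its coordinates
   beyond the k-th carry a fraction of order q^(2k) of its squared norm.
   On the other hand A b is a multiple of bhat, which lives in two coordinates,
   and A^2 is tridiagonal, so that by induction Hx k is supported in the first
   k coordinates, and A (Hy k) in the first k + 1.  The gap bound follows from
   the distance bound by strong convexity. *)

Require Import Defs.
From HB Require Import structures.
From mathcomp Require Import all_boot all_order all_algebra.
From mathcomp Require Import all_classical all_reals all_analysis.
From mathcomp Require Import ring lra zify.

Set Implicit Arguments.
Unset Strict Implicit.
Unset Printing Implicit Defensive.

Import Order.TTheory GRing.Theory Num.Theory.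
Import numFieldNormedType.Exports.

Local Open Scope classical_set_scope.
Local Open Scope ring_scope.

(** * Quadratic forms and their gradients *)

Definition dot {R : realType} {n : nat} (u v : 'cV[R]_n) : R := (u^T *m v) 0 0.

Lemma dotE (R : realType) n (u v : 'cV[R]_n) :
  dot u v = \sum_(i < n) u i 0 * v i 0.
Proof. by rewrite /dot mxE; apply: eq_bigr => i _; rewrite mxE. Qed.

Lemma dotC (R : realType) n (u v : 'cV[R]_n) : dot u v = dot v u.
Proof. by rewrite !dotE; apply: eq_bigr => i _; rewrite mulrC. Qed.

Lemma dotDr (R : realType) n (u v w : 'cV[R]_n) :
  dot u (v + w) = dot u v + dot u w.
Proof. by rewrite /dot mulmxDr mxE. Qed.

Lemma dotDl (R : realType) n (u v w : 'cV[R]_n) :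
  dot (v + w) u = dot v u + dot w u.
Proof. by rewrite dotC dotDr !(dotC u). Qed.

Lemma dotZr (R : realType) n a (u v : 'cV[R]_n) : dot u (a *: v) = a * dot u v.
Proof. by rewrite /dot -scalemxAr mxE. Qed.

Lemma dotZl (R : realType) n a (u v : 'cV[R]_n) : dot (a *: u) v = a * dot u v.
Proof. by rewrite dotC dotZr dotC. Qed.

Lemma dotNr (R : realType) n (u v : 'cV[R]_n) : dot u (- v) = - dot u v.
Proof. by rewrite -scaleN1r dotZr mulN1r. Qed.

Lemma dotNl (R : realType) n (u v : 'cV[R]_n) : dot (- u) v = - dot u v.
Proof. by rewrite dotC dotNr dotC. Qed.

Lemma dot0r (R : realType) n (u : 'cV[R]_n) : dot u 0 = 0.
Proof. by rewrite -(scale0r 0) dotZr mul0r. Qed.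

Definition dot_lin := (dotDl, dotDr, dotNl, dotNr, dotZl, dotZr).

Lemma dot_mul (R : realType) n m (M : 'M[R]_(n, m)) u v :
  dot u (M *m v) = dot (M^T *m u) v.
Proof. by rewrite /dot trmx_mul trmxK mulmxA. Qed.

Lemma dot_ge0 (R : realType) n (u : 'cV[R]_n) : 0 <= dot u u.
Proof. by rewrite dotE sumr_ge0// => i _; rewrite -expr2 sqr_ge0. Qed.

Lemma dot_eq0 (R : realType) n (u : 'cV[R]_n) : dot u u <= 0 -> u = 0.
Proof.
move=> u_le0; have /eqP : dot u u = 0 by apply/le_anti; rewrite u_le0 dot_ge0.
rewrite dotE psumr_eq0 => [/allP u0|i _]; last by rewrite -expr2 sqr_ge0.
apply/matrixP => i j; rewrite ord1 mxE; apply/eqP.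
by have := u0 i (mem_index_enum _); rewrite /= -expr2 sqrf_eq0.
Qed.

Lemma sqr_enorm (R : realType) n (u : 'cV[R]_n) : enorm u ^+ 2 = dot u u.
Proof.
rewrite sqr_sqrtr; first by rewrite dotE; apply: eq_bigr => i _; rewrite expr2.
by rewrite sumr_ge0// => i _; rewrite sqr_ge0.
Qed.

Lemma enorm_le (R : realType) n m (c : R) (u : 'cV[R]_n) (v : 'cV[R]_m) :
  0 <= c -> dot u u <= c ^+ 2 * dot v v -> enorm u <= c * enorm v.
Proof.
move=> c0 uv; rewrite -(@ler_pXn2r _ 2)// ?nnegrE ?mulr_ge0 ?sqrtr_ge0//.
by rewrite exprMn !sqr_enorm.
Qed.

(** Each row of the left kernel of [M^T] is, once transposed, a vector killed by [M], so injectivity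
    makes that kernel zero. *)
Lemma unitmx_inj (F : fieldType) n (M : 'M[F]_n) :
  (forall x : 'cV[F]_n, M *m x = 0 -> x = 0) -> M \in unitmx.
Proof.
move=> Minj; rewrite -unitmx_tr -row_free_unit -kermx_eq0.
apply/eqP/row_matrixP => i; rewrite row0 -[RHS]trmx0 -[LHS]trmxK; congr _^T.
apply: Minj; rewrite -[LHS]trmxK trmx_mul trmxK -row_mul mulmx_ker row0.
by rewrite trmx0.
Qed.

Lemma posdef_unitmx (R : realType) n mu (M : 'M[R]_n) : 0 < mu ->
  (forall x, mu * dot x x <= dot x (M *m x)) -> M \in unitmx.
Proof.
move=> mu0 Mpos; apply: unitmx_inj => x Mx0; apply: dot_eq0.
by have := Mpos x; rewrite Mx0 dot0r pmulr_rle0.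
Qed.

(** The expansion is exact, so the difference quotient along the basis vector [v] is [dot g v] plus
    [h] times a constant, which tends to [g i 0]. *)
Lemma gradient_quadratic (R : realType) n (f : 'cV[R]_n -> R) x g
    (M : 'M[R]_n) :
  (forall h, f (h + x) = f x + dot g h + dot h (M *m h)) -> gradient f x = g.
Proof.
move=> fE; apply/matrixP => i j; rewrite ord1 mxE /derive.
set v := delta_mx i 0; apply: cvg_lim => //=.
have -> : g i 0 = dot g v.
  rewrite dotE (bigD1 i)//= mxE !eqxx mulr1 big1 ?addr0// => k ki.
  by rewrite mxE (negbTE ki) mulr0.
apply: (@cvg_trans _ ((fun h => dot g v + h * dot v (M *m v)) @ 0^')).
  apply: near_eq_cvg; near=> h.
  have h0 : h != 0 by near: h; exact: nbhs_dnbhs_neq.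
  rewrite /= /shift /= fE -scalemxAr !dot_lin -[_ *: _]/(_ * _).
  by field.
apply: cvg_within_filter.
have := @cvgD _ _ _ (nbhs (0 : R)) _ (fun=> dot g v) (fun h => h * dot v (M *m v))
  _ _ (cvg_cst (dot g v)) (cvgMl cvg_id).
rewrite mul0r addr0; apply; exact: nbhs_filter.
Unshelve. all: by end_near. Qed.

(** * Continuity and differentiability by coordinates *)

Lemma continuous_mx (R : realType) (T : topologicalType) m n
    (f : T -> 'M[R]_(m, n)) :
  (forall i j, continuous (fun t => f t i j)) -> continuous f.
Proof.
move=> fc t; apply/cvgrPdist_le => /= e e0; near=> s.
rewrite [leLHS]/Num.Def.normr/= mx_normrE (bigmax_le _ (ltW e0))//= => i _.
rewrite !mxE/=; move: i; near: s; apply: filter_forall => /= i.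
have := fc i.1 i.2 t; move=> /cvgrPdist_le; exact.
Unshelve. all: by end_near. Qed.

Definition coord_diff {R : realType} {V : normedModType R} {n : nat}
  (f : V -> 'cV[R]_n) := forall i p, differentiable (fun p => f p i 0) p.

Lemma coord_diff_mul (R : realType) (V : normedModType R) m n
    (M : 'M[R]_(m, n)) (f : V -> 'cV[R]_n) :
  coord_diff f -> coord_diff (fun p => M *m f p).
Proof.
move=> df i p; rewrite (_ : (fun _ => _) =
    \sum_(j < n) (cst (M i j) * (fun p => f p j 0))).
  by apply: differentiable_sum => j; apply: differentiableM.
by apply/funext => q; rewrite mxE fct_sumE.
Qed.

Lemma coord_diffD (R : realType) (V : normedModType R) n
    (f g : V -> 'cV[R]_n) :
  coord_diff f -> coord_diff g -> coord_diff (fun p => f p + g p).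
Proof.
move=> df dg i p; rewrite (_ : (fun _ => _) =
  (fun p => f p i 0) + (fun p => g p i 0)); first exact: differentiableD.
by apply/funext => q; rewrite mxE.
Qed.

Lemma differentiable_dot (R : realType) (V : normedModType R) n
    (f g : V -> 'cV[R]_n) p :
  coord_diff f -> coord_diff g -> differentiable (fun p => dot (f p) (g p)) p.
Proof.
move=> df dg; rewrite (_ : (fun _ => _) =
    \sum_(j < n) ((fun p => f p j 0) * (fun p => g p j 0))).
  by apply: differentiable_sum => j; apply: differentiableM.
by apply/funext => q; rewrite dotE fct_sumE.
Qed.

Lemma coord_diff_continuous (R : realType) (V : normedModType R) n
    (f : V -> 'cV[R]_n) : coord_diff f -> continuous f.
Proof.
move=> df; apply: continuous_mx => i j; rewrite ord1 => p.
exact/differentiable_continuous.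
Qed.

Lemma coord_diff_fst (R : realType) n m :
  coord_diff (fun p : 'cV[R]_n * 'cV[R]_m => p.1).
Proof.
move=> i p; have @f : {linear ('cV[R]_n * 'cV[R]_m)%type -> R}.
  by exists (fun p : 'cV[R]_n * 'cV[R]_m => p.1 i 0); do 2![eexists]; do ?[constructor];
     rewrite ?mxE// => ? *; rewrite ?mxE//; move=> ?; rewrite !mxE.
rewrite (_ : (fun _ => _) = f)//; apply: linear_differentiable => q.
apply: (@continuous_comp _ _ _ fst (fun x : 'cV[R]_n => x i 0)).
  exact: cvg_fst.
exact: coord_continuous.
Qed.

Lemma coord_diff_snd (R : realType) n m :
  coord_diff (fun p : 'cV[R]_n * 'cV[R]_m => p.2).
Proof.
move=> i p; have @f : {linear ('cV[R]_n * 'cV[R]_m)%type -> R}.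
  by exists (fun p : 'cV[R]_n * 'cV[R]_m => p.2 i 0); do 2![eexists]; do ?[constructor];
     rewrite ?mxE// => ? *; rewrite ?mxE//; move=> ?; rewrite !mxE.
rewrite (_ : (fun _ => _) = f)//; apply: linear_differentiable => q.
apply: (@continuous_comp _ _ _ snd (fun x : 'cV[R]_m => x i 0)).
  exact: cvg_snd.
exact: coord_continuous.
Qed.

(** * Quadratic saddle functions *)

(** The common shape of the saddle function in [x] for fixed [y] and of its negative in [y] for
    fixed [x]; [d] collects the terms of the fixed variable. *)
Definition quad {R : realType} {n} (P : 'M[R]_n) (c : 'cV[R]_n) (d : R)
  (x : 'cV[R]_n) : R := 1 / 2 * dot x (P *m x) + dot c x + d.

Lemma quadD (R : realType) n (P : 'M[R]_n) c d h x : P^T = P ->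
  quad P c d (h + x) =
    quad P c d x + dot (P *m x + c) h + dot h (((1 / 2) *: P) *m h).
Proof.
move=> PT; rewrite /quad mulmxDr -scalemxAl !dot_lin (dot_mul P x h) PT.
by rewrite (dotC (P *m x) h) (dotC c h); field.
Qed.

Lemma gradient_quad (R : realType) n (P : 'M[R]_n) c d x : P^T = P ->
  gradient (quad P c d) x = P *m x + c.
Proof. by move=> PT; apply: gradient_quadratic => h; exact: quadD. Qed.

(** The convexity defect is exactly [t * (1 - t) / 2] times the quadratic form of [P] at
    [x1 - x2]. *)
Lemma strongly_convex_quad (R : realType) n mu (P : 'M[R]_n) c d : P^T = P ->
  (forall x, mu * dot x x <= dot x (P *m x)) -> strongly_convex mu (quad P c d).
Proof.
move=> PT Pmu x1 x2 t /andP[t0]; rewrite -subr_ge0 => t1.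
have := ler_wpM2l (mulr_ge0 t0 t1) (Pmu (x1 - x2)).
rewrite sqr_enorm /quad !(mulmxDr, mulmxN) -!scalemxAr !dot_lin.
rewrite (dot_mul P x2 x1) PT (dotC (P *m x2) x1) (dotC x2 x1).
lra.
Qed.

(** Completing the square: the linear term of the expansion vanishes at [xs]. *)
Lemma quad_stationary (R : realType) n (P : 'M[R]_n) c d xs x : P^T = P ->
  P *m xs + c = 0 ->
  quad P c d x = quad P c d xs + 1 / 2 * dot (x - xs) (P *m (x - xs)).
Proof.
move=> PT st; rewrite -{1}(subrK xs x) quadD// st dotC dot0r addr0.
by rewrite -scalemxAl dotZr.
Qed.

Lemma quad_min (R : realType) n mu (P : 'M[R]_n) c d : P^T = P -> 0 < mu ->
  (forall x, mu * dot x x <= dot x (P *m x)) ->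
  exists m, is_min (range (quad P c d)) m.
Proof.
move=> PT mu0 Pmu; have Pu := posdef_unitmx mu0 Pmu.
pose xs := - (invmx P *m c).
have st : P *m xs + c = 0 by rewrite mulmxN mulKVmx// addNr.
exists (quad P c d xs); split; first by exists xs.
move=> _ [x _ <-]; rewrite [leRHS](quad_stationary _ _ PT st) lerDl.
by rewrite mulr_ge0// (le_trans _ (Pmu _))// mulr_ge0 ?dot_ge0 ?ltW.
Qed.

Definition bilin_saddle {R : realType} {n m : nat} (P : 'M[R]_n) (Q : 'M[R]_m)
    (K : 'M[R]_(n, m)) (b : 'cV[R]_m) (x : 'cV[R]_n) (y : 'cV[R]_m) : R :=
  1 / 2 * dot x (P *m x) + dot x (K *m y) - 1 / 2 * dot y (Q *m y) - dot b y.

Lemma bilin_saddle_x (R : realType) n m (P : 'M[R]_n) (Q : 'M[R]_m) K b y :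
  bilin_saddle P Q K b ^~ y =
    quad P (K *m y) (- (1 / 2) * dot y (Q *m y) - dot b y).
Proof.
by apply/funext => x; rewrite /bilin_saddle /quad (dotC (K *m y)); ring.
Qed.

(** The sign turns maximisation in [y] into minimisation, so the facts on [quad] serve both
    variables. *)
Lemma bilin_saddle_y (R : realType) n m (P : 'M[R]_n) (Q : 'M[R]_m) K b x :
  (fun y => - bilin_saddle P Q K b x y) =
    quad Q (b - K^T *m x) (- (1 / 2) * dot x (P *m x)).
Proof.
apply/funext => y; rewrite /bilin_saddle /quad !dot_lin (dot_mul K).
by ring.
Qed.

Lemma grad_x_bilin_saddle (R : realType) n m (P : 'M[R]_n) (Q : 'M[R]_m) K b x y :
  P^T = P -> grad_x (bilin_saddle P Q K b) x y = P *m x + K *m y.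
Proof. by move=> PT; rewrite /grad_x bilin_saddle_x gradient_quad. Qed.

Lemma grad_y_bilin_saddle (R : realType) n m (P : 'M[R]_n) (Q : 'M[R]_m) K b x y :
  Q^T = Q -> grad_y (bilin_saddle P Q K b) x y = K^T *m x - Q *m y - b.
Proof.
move=> QT; rewrite /grad_y.
apply: (@gradient_quadratic _ _ _ _ _ (- ((1 / 2) *: Q))) => h.
apply: oppr_inj.
have := congr1 (fun f => f (h + y)) (bilin_saddle_y P Q K b x).
have := congr1 (fun f => f y) (bilin_saddle_y P Q K b x).
move=> /= Ey ->; rewrite quadD// -Ey [RHS]opprD [X in _ = X + _]opprD.
rewrite mulNmx dotNr opprK -dotNl; congr (_ + dot _ _ + _).
by rewrite !opprD !opprK addrA addrC addrA.
Qed.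

Lemma smooth_bilin_saddle (R : realType) n m (P : 'M[R]_n) (Q : 'M[R]_m) K b :
  P^T = P -> Q^T = Q -> smooth (bilin_saddle P Q K b).
Proof.
move=> PT QT; have d1 := @coord_diff_fst R n m; have d2 := @coord_diff_snd R n m.
split=> [p||].
- rewrite /bilin_saddle; apply: differentiableB; last first.
    by apply: differentiable_dot d2 => i q; exact: differentiable_cst.
  apply: differentiableB; last first.
    apply: differentiableM => //.
    by apply: differentiable_dot => //; exact: coord_diff_mul.
  apply: differentiableD; last first.
    by apply: differentiable_dot => //; exact: coord_diff_mul.
  apply: differentiableM => //.
  by apply: differentiable_dot => //; exact: coord_diff_mul.
- rewrite (_ : (fun _ => _) = fun p => P *m p.1 + K *m p.2).
    by apply: coord_diff_continuous; apply: coord_diffD; exact: coord_diff_mul.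
  by apply/funext => p; exact: grad_x_bilin_saddle.
- rewrite (_ : (fun _ => _) = fun p => K^T *m p.1 + (- Q) *m p.2 + (- b)).
    apply: coord_diff_continuous; apply: coord_diffD.
      by apply: coord_diffD; exact: coord_diff_mul.
    by move=> i q; exact: differentiable_cst.
  by apply/funext => p; rewrite mulNmx grad_y_bilin_saddle.
Qed.

Lemma problem_class_bilin_saddle (R : realType) n m Lx Ly Lxy mux muy
    (P : 'M[R]_n) (Q : 'M[R]_m) K b :
  P^T = P -> Q^T = Q -> 0 <= Lx -> 0 <= Ly -> 0 <= Lxy ->
  (forall x, mux * dot x x <= dot x (P *m x)) ->
  (forall y, muy * dot y y <= dot y (Q *m y)) ->
  (forall x, dot (P *m x) (P *m x) <= Lx ^+ 2 * dot x x) ->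
  (forall y, dot (Q *m y) (Q *m y) <= Ly ^+ 2 * dot y y) ->
  (forall y, dot (K *m y) (K *m y) <= Lxy ^+ 2 * dot y y) ->
  (forall x, dot (K^T *m x) (K^T *m x) <= Lxy ^+ 2 * dot x x) ->
  problem_class Lx Ly Lxy mux muy (bilin_saddle P Q K b).
Proof.
move=> PT QT Lx0 Ly0 Lxy0 Pmu Qmu PL QL KL KTL.
split; first exact: smooth_bilin_saddle.
split; first by move=> y; rewrite bilin_saddle_x; exact: strongly_convex_quad.
split.
  by move=> x; rewrite /strongly_concave bilin_saddle_y; exact: strongly_convex_quad.
split=> [x1 x2 y|]; last split=> [x y1 y2|]; last split=> [x y1 y2|x1 x2 y];
  rewrite !(grad_x_bilin_saddle, grad_y_bilin_saddle)//.
- by rewrite opprD addrACA subrr addr0 -mulmxBr; exact: enorm_le.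
- rewrite (_ : _ - _ = - (Q *m (y1 - y2))).
    by apply: enorm_le; rewrite // dotNl dotNr opprK.
  rewrite mulmxBr; move: (Q *m y1) (Q *m y2) (K^T *m x) => u v w.
  by apply/matrixP => i j; rewrite !mxE; ring.
- by rewrite opprD addrACA subrr add0r -mulmxBr; exact: enorm_le.
- rewrite (_ : _ - _ = K^T *m (x1 - x2)); first exact: enorm_le.
  rewrite mulmxBr; move: (K^T *m x1) (K^T *m x2) (Q *m y) => u v w.
  by apply/matrixP => i j; rewrite !mxE; ring.
Qed.

Lemma bilin_saddle_stationary (R : realType) n m (P : 'M[R]_n) (Q : 'M[R]_m) K b
    xs ys : P^T = P -> Q^T = Q ->
  P *m xs + K *m ys = 0 -> K^T *m xs - Q *m ys - b = 0 ->
  (forall x, bilin_saddle P Q K b x ys = bilin_saddle P Q K b xs ys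
     + 1 / 2 * dot (x - xs) (P *m (x - xs))) /\
  (forall y, bilin_saddle P Q K b xs y = bilin_saddle P Q K b xs ys
     - 1 / 2 * dot (y - ys) (Q *m (y - ys))).
Proof.
move=> PT QT stx sty; split => [x|y].
  have Ex z := congr1 (fun f => f z) (bilin_saddle_x P Q K b ys).
  by rewrite (Ex x) (Ex xs); exact: quad_stationary.
apply: oppr_inj; have Ey z := congr1 (fun f => f z) (bilin_saddle_y P Q K b xs).
rewrite [RHS]opprD opprK (Ey y) (Ey ys); apply: quad_stationary => //.
by rewrite -[RHS]oppr0 -sty !opprD !opprK addrA addrC addrA.
Qed.

Lemma saddle_bilin_saddle (R : realType) n m mux muy (P : 'M[R]_n) (Q : 'M[R]_m)
    K b xs ys : P^T = P -> Q^T = Q -> 0 < mux -> 0 < muy ->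
  (forall x, mux * dot x x <= dot x (P *m x)) ->
  (forall y, muy * dot y y <= dot y (Q *m y)) ->
  P *m xs + K *m ys = 0 -> K^T *m xs - Q *m ys - b = 0 ->
  saddle_point (bilin_saddle P Q K b) xs ys /\
  forall xs' ys', saddle_point (bilin_saddle P Q K b) xs' ys' ->
    xs' = xs /\ ys' = ys.
Proof.
move=> PT QT mux0 muy0 Pmu Qmu stx sty.
have [Fx Fy] := bilin_saddle_stationary PT QT stx sty.
have P0 x : 0 <= dot x (P *m x).
  by rewrite (le_trans _ (Pmu _))// mulr_ge0 ?dot_ge0 ?ltW.
have Q0 y : 0 <= dot y (Q *m y).
  by rewrite (le_trans _ (Qmu _))// mulr_ge0 ?dot_ge0 ?ltW.
split=> [x y|x y F'].
  by rewrite (Fx x) (Fy y); have := P0 (x - xs); have := Q0 (y - ys); split; lra.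
(* Chaining the two inequalities gives F(x, ys) <= F(xs, y). After expansion around (xs, ys), a sum
   of two nonnegative forms is at most 0, so both vanish. *)
have [F1 F2] := F' xs ys; rewrite (Fx x) in F1; rewrite (Fy y) in F2.
split; apply/eqP; rewrite -subr_eq0; apply/eqP/dot_eq0.
- rewrite -(pmulr_rle0 _ mux0) (le_trans (Pmu _))//.
  by have := Q0 (y - ys); lra.
- rewrite -(pmulr_rle0 _ muy0) (le_trans (Qmu _))//.
  by have := P0 (x - xs); lra.
Qed.

(* The duality gap at (xt, yt) is at least F(xt, ys) - F(xs, yt). *)
Lemma gap_bilin_saddle (R : realType) n m mux muy (P : 'M[R]_n) (Q : 'M[R]_m)
    K b xs ys xt yt : P^T = P -> Q^T = Q -> 0 < mux -> 0 < muy ->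
  (forall x, mux * dot x x <= dot x (P *m x)) ->
  (forall y, muy * dot y y <= dot y (Q *m y)) ->
  P *m xs + K *m ys = 0 -> K^T *m xs - Q *m ys - b = 0 ->
  exists M m, [/\ is_max (range (bilin_saddle P Q K b xt)) M,
    is_min (range (bilin_saddle P Q K b ^~ yt)) m
    & mux / 2 * dot (xt - xs) (xt - xs) <= M - m].
Proof.
move=> PT QT mux0 muy0 Pmu Qmu stx sty.
have [Fx Fy] := bilin_saddle_stationary PT QT stx sty.
have [mx mxP] := quad_min (K *m yt) (- (1 / 2) * dot yt (Q *m yt) - dot b yt)
  PT mux0 Pmu.
have [my] := quad_min (b - K^T *m xt) (- (1 / 2) * dot xt (P *m xt)) QT muy0 Qmu.
rewrite -bilin_saddle_x in mxP; rewrite -bilin_saddle_y => -[[y _ Ey] ymin].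
have ymax z : bilin_saddle P Q K b xt z <= - my.
  by rewrite lerNr; apply: ymin; exists z.
exists (- my), mx; split=> //.
  by split; [exists y => //; rewrite -Ey opprK|move=> _ [z _ <-]; exact: ymax].
have := ymax ys; have := mxP.2 _ (imageP _ (I : setT xs)) => /=.
rewrite (Fx xt) (Fy yt); have := Pmu (xt - xs).
have : 0 <= dot (yt - ys) (Q *m (yt - ys)).
  by rewrite (le_trans _ (Qmu _))// mulr_ge0 ?dot_ge0 ?ltW.
lra.
Qed.

(** * The matrix A *)

(* The coordinates of [x], extended by zero beyond [n]: with this convention
   the boundary rows of [Amx] have the same form as the others. *)
Definition zcoef {R : realType} {n : nat} (x : 'cV[R]_n) (i : nat) : R :=
  \sum_(j < n) (if j == i :> nat then x j 0 else 0).

Lemma zcoef_ord (R : realType) n (x : 'cV[R]_n) (i : 'I_n) : zcoef x i = x i 0.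
Proof.
rewrite /zcoef (bigD1 i)//= eqxx big1 ?addr0// => j ji.
by rewrite ifN//; apply: contra ji => /eqP/val_inj ->.
Qed.

Lemma zcoef_ge (R : realType) n (x : 'cV[R]_n) i : (n <= i)%N -> zcoef x i = 0.
Proof.
move=> ni; rewrite /zcoef big1// => j _; rewrite ifN//.
by rewrite neq_ltn (leq_trans (ltn_ord j)).
Qed.

Lemma zcoef_col (R : realType) n (f : nat -> R) i : (i < n)%N ->
  zcoef (\col_(j < n) f j) i = f i.
Proof. by move=> ni; rewrite -[i]/(val (Ordinal ni)) zcoef_ord mxE. Qed.

Lemma zcoefD (R : realType) n (x y : 'cV[R]_n) i :
  zcoef (x + y) i = zcoef x i + zcoef y i.
Proof.
by rewrite /zcoef -big_split; apply: eq_bigr => j _ /=; case: ifP; rewrite ?addr0 ?mxE.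
Qed.

Lemma zcoefZ (R : realType) n a (x : 'cV[R]_n) i : zcoef (a *: x) i = a * zcoef x i.
Proof.
by rewrite /zcoef mulr_sumr; apply: eq_bigr => j _; case: ifP; rewrite ?mulr0 ?mxE.
Qed.

Lemma zcoef0 (R : realType) n i : zcoef (0 : 'cV[R]_n) i = 0.
Proof. by rewrite -(scale0r 0) zcoefZ mul0r. Qed.

Lemma zcoefN (R : realType) n (x : 'cV[R]_n) i : zcoef (- x) i = - zcoef x i.
Proof. by rewrite -scaleN1r zcoefZ mulN1r. Qed.

Lemma eq_zcoef (R : realType) n (x y : 'cV[R]_n) :
  (forall i, (i < n)%N -> zcoef x i = zcoef y i) -> x = y.
Proof. by move=> xy; apply/matrixP => i j; rewrite ord1 -!zcoef_ord xy. Qed.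

Lemma dot_zcoef (R : realType) n (x : 'cV[R]_n) :
  dot x x = \sum_(i < n) zcoef x i ^+ 2.
Proof. by rewrite dotE; apply: eq_bigr => i _; rewrite zcoef_ord expr2. Qed.

(** [Amx] reverses the coordinates and takes differences of neighbours. For [i = 0] the second term
    has index [n] and is 0 by the zero extension. *)
Lemma zcoef_Amx (R : realType) n (x : 'cV[R]_n) i : (i < n)%N ->
  zcoef (Amx R n *m x) i = zcoef x (n - i.+1) - zcoef x (n - i).
Proof.
move=> ni; rewrite -[X in zcoef _ X]/(val (Ordinal ni)) zcoef_ord mxE /zcoef -sumrB.
apply: eq_bigr => j _; rewrite mxE /=.
have -> : ((i + j).+1 == n) = (j == (n - i.+1)%N :> nat) by lia.
have -> : ((i + j)%N == n) = (j == (n - i)%N :> nat) by lia.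
case: eqP => e1; case: eqP => e2; rewrite ?(mul1r, mulN1r, mul0r, subr0, sub0r)//.
by lia.
Qed.

Lemma tr_Amx (R : realType) n : (Amx R n)^T = Amx R n.
Proof. by apply/matrixP => i j; rewrite !mxE addnC. Qed.

(** In reversed order the entries of the image are x_i - x_(i+1), with square at most 2 x_i^2 + 2
    x_(i+1)^2. The operator norm is thus at most 2, whence the factor 4 between [B] and [L - mu]. *)
Lemma dot_Amx_le (R : realType) n (x : 'cV[R]_n) :
  dot (Amx R n *m x) (Amx R n *m x) <= 4 * dot x x.
Proof.
rewrite !dot_zcoef (reindex_inj rev_ord_inj)/=.
(* Shifting drops the term of index 0 and adds that of index [n], which is 0. *)
have shift : \sum_(i < n) zcoef x i.+1 ^+ 2 <= \sum_(i < n) zcoef x i ^+ 2.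
  have := @big_ord_recl _ 0 +%R n (fun i : 'I_n.+1 => zcoef x i ^+ 2) => /=.
  rewrite big_ord_recr/= (zcoef_ge x (leqnn n)) expr0n addr0 => ->.
  by rewrite lerDr sqr_ge0.
apply: (@le_trans _ _ (\sum_(i < n) (2 * zcoef x i ^+ 2 + 2 * zcoef x i.+1 ^+ 2))).
  apply: ler_sum => i _; rewrite zcoef_Amx ?rev_ord_proof//.
  rewrite (_ : (n - (n - i.+1).+1)%N = i); last by have := ltn_ord i; lia.
  rewrite (_ : (n - (n - i.+1))%N = i.+1); last by have := ltn_ord i; lia.
  by rewrite -subr_ge0 (_ : _ - _ = (zcoef x i + zcoef x i.+1) ^+ 2) ?sqr_ge0//; ring.
by rewrite big_split/= -!mulr_sumr; lra.
Qed.

(** Back substitution: row [j] equates the coefficients at [n - j.+1] and [n - j], starting from the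
    zero coefficient at [n]. *)
Lemma Amx_inj (R : realType) n (x : 'cV[R]_n) : Amx R n *m x = 0 -> x = 0.
Proof.
move=> Ax0; apply: eq_zcoef => i ni; rewrite zcoef0.
suff H j : (j <= n)%N -> zcoef x (n - j) = 0.
  by rewrite (_ : i = (n - (n - i))%N) ?H//; lia.
elim: j => [_|j IHj nj]; first by rewrite zcoef_ge// subn0.
by have := zcoef_Amx x nj; rewrite Ax0 (IHj (ltnW nj)) subr0 zcoef0.
Qed.

Lemma Amx_unit (R : realType) n : Amx R n \in unitmx.
Proof. exact/unitmx_inj/Amx_inj. Qed.

Lemma sqr_AmxE (R : realType) n (x : 'cV[R]_n) :
  Amx R n ^+ 2 *m x = Amx R n *m (Amx R n *m x).
Proof. by rewrite expr2 mulmxA. Qed.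

(* [Amx ^+ 2] is the path Laplacian, Neumann at 0 and Dirichlet at n. *)
Lemma zcoef_sqr_Amx0 (R : realType) n (x : 'cV[R]_n) : (0 < n)%N ->
  zcoef (Amx R n ^+ 2 *m x) 0 = zcoef x 0 - zcoef x 1.
Proof.
move=> n0; rewrite sqr_AmxE zcoef_Amx// (@zcoef_ge _ _ _ (n - 0)) ?subn0// subr0.
by rewrite zcoef_Amx ?subn1 ?prednK// subnn -subn1 subKn.
Qed.

Lemma zcoef_sqr_AmxS (R : realType) n (x : 'cV[R]_n) i : (i.+1 < n)%N ->
  zcoef (Amx R n ^+ 2 *m x) i.+1 = 2 * zcoef x i.+1 - zcoef x i - zcoef x i.+2.
Proof.
move=> ni; rewrite sqr_AmxE zcoef_Amx// !zcoef_Amx; try lia.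
rewrite (_ : (n - (n - i.+2).+1)%N = i.+1); last lia.
rewrite (_ : (n - (n - i.+2))%N = i.+2); last lia.
rewrite (_ : (n - (n - i.+1).+1)%N = i); last lia.
rewrite (_ : (n - (n - i.+1))%N = i.+1); last lia.
by ring.
Qed.

Lemma tr_sqr_Amx (R : realType) n : (Amx R n ^+ 2)^T = Amx R n ^+ 2.
Proof. by rewrite expr2 trmx_mul tr_Amx. Qed.

Lemma dot_sqr_Amx (R : realType) n (x : 'cV[R]_n) :
  dot x (Amx R n ^+ 2 *m x) = dot (Amx R n *m x) (Amx R n *m x).
Proof. by rewrite sqr_AmxE dot_mul tr_Amx. Qed.

(** * The diagonal blocks of the instance and its membership in the class *)

Definition shifted_sqr_Amx {R : realType} n (B mu : R) : 'M[R]_n :=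
  B *: Amx R n ^+ 2 + mu *: 1%:M.

Lemma shifted_sqr_AmxE (R : realType) n (B mu : R) (x : 'cV[R]_n) :
  shifted_sqr_Amx n B mu *m x = B *: (Amx R n ^+ 2 *m x) + mu *: x.
Proof. by rewrite mulmxDl -!scalemxAl mul1mx. Qed.

Lemma tr_shifted_sqr_Amx (R : realType) n (B mu : R) :
  (shifted_sqr_Amx n B mu)^T = shifted_sqr_Amx n B mu.
Proof. by rewrite raddfD/= !linearZ/= tr_sqr_Amx trmx1. Qed.

Lemma shifted_sqr_Amx_ge (R : realType) n (B mu : R) (x : 'cV[R]_n) : 0 <= B ->
  mu * dot x x <= dot x (shifted_sqr_Amx n B mu *m x).
Proof.
move=> B0; rewrite shifted_sqr_AmxE !dot_lin lerDr mulr_ge0// dot_sqr_Amx.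
exact: dot_ge0.
Qed.

(** Expand the square and bound |A^2 x|^2 by 16 |x|^2 and the cross term |A x|^2 by 4 |x|^2; the
    result is a perfect square. *)
Lemma shifted_sqr_Amx_le (R : realType) n (B mu : R) (x : 'cV[R]_n) :
  0 <= B -> 0 <= mu ->
  dot (shifted_sqr_Amx n B mu *m x) (shifted_sqr_Amx n B mu *m x) <=
    (4 * B + mu) ^+ 2 * dot x x.
Proof.
move=> B0 mu0; rewrite shifted_sqr_AmxE !dot_lin (dotC _ x) dot_sqr_Amx.
have A1 := dot_Amx_le x; have A2 := dot_Amx_le (Amx R n *m x).
rewrite -sqr_AmxE in A2.
have h1 := ler_wpM2l (mulr_ge0 B0 B0) A2.
have h2 := ler_wpM2l (mulr_ge0 B0 B0) A1.
have h3 := ler_wpM2l (mulr_ge0 B0 mu0) A1.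
lra.
Qed.

Lemma hard_instanceE (R : realType) n (Bx By Lxy mux muy : R) (b : 'cV[R]_n) :
  hard_instance Bx By Lxy mux muy b =
    bilin_saddle (shifted_sqr_Amx n Bx mux) (shifted_sqr_Amx n By muy)
      ((Lxy / 2) *: Amx R n) b.
Proof.
apply/funext => x; apply/funext => y.
rewrite /bilin_saddle -(scalemxAl (Lxy / 2)) dotZr.
by rewrite /hard_instance /qform /dot !mulmxA.
Qed.

Lemma problem_class_hard_instance (R : realType) n (Bx By Lxy mux muy : R)
    (b : 'cV[R]_n) : 0 < mux -> 0 < muy -> 0 < Bx -> 0 < By -> 0 < Lxy ->
  problem_class (4 * Bx + mux) (4 * By + muy) Lxy mux muy
    (hard_instance Bx By Lxy mux muy b).
Proof.
move=> mux0 muy0 Bx0 By0 Lxy0; rewrite hard_instanceE.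
have KL x : dot ((Lxy / 2) *: Amx R n *m x) ((Lxy / 2) *: Amx R n *m x) <=
    Lxy ^+ 2 * dot x x.
  rewrite -scalemxAl !dot_lin.
  have := ler_wpM2l (sqr_ge0 (Lxy / 2)) (dot_Amx_le x); lra.
apply: problem_class_bilin_saddle; rewrite ?tr_shifted_sqr_Amx//.
- by rewrite addr_ge0 ?mulr_ge0 ?ltW.
- by rewrite addr_ge0 ?mulr_ge0 ?ltW.
- exact: ltW.
- by move=> x; apply/shifted_sqr_Amx_ge/ltW.
- by move=> x; apply/shifted_sqr_Amx_ge/ltW.
- by move=> x; apply: shifted_sqr_Amx_le; exact: ltW.
- by move=> x; apply: shifted_sqr_Amx_le; exact: ltW.
- by move=> x; rewrite linearZ/= tr_Amx.
Qed.

(** * Support of the iterates *)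

(** Stated through [zcoef], so that [k] may exceed [n]. *)
Definition supported {R : realType} {n : nat} (k : nat) (v : 'cV[R]_n) : Prop :=
  forall i, (k <= i)%N -> zcoef v i = 0.

Lemma supported0 (R : realType) n k : supported k (0 : 'cV[R]_n).
Proof. by move=> i _; rewrite zcoef0. Qed.

Lemma supported_lin (R : realType) n k a (u v : 'cV[R]_n) :
  supported k u -> supported k v -> supported k (a *: u + v).
Proof. by move=> su sv i ki; rewrite zcoefD zcoefZ su// sv// mulr0 addr0. Qed.

Lemma supportedW (R : realType) n k l (u : 'cV[R]_n) : (k <= l)%N ->
  supported k u -> supported l u.
Proof. by move=> kl su i li; apply/su/(leq_trans kl). Qed.

Lemma supportedZ (R : realType) n k a (u : 'cV[R]_n) :
  supported k u -> supported k (a *: u).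
Proof. by move=> su; rewrite -[_ *: _]addr0; apply/supported_lin/supported0. Qed.

(** [Amx ^+ 2] is tridiagonal, so it enlarges a prefix by one coordinate. *)
Lemma supported_sqr_Amx (R : realType) n k (u : 'cV[R]_n) :
  supported k u -> supported k.+1 (Amx R n ^+ 2 *m u).
Proof.
move=> su [//|i] ki; case: (ltnP i.+1 n) => ni; last exact: zcoef_ge.
by rewrite zcoef_sqr_AmxS// !su ?mulr0 ?subr0// ?(leq_trans ki)//; lia.
Qed.

Lemma supported_shifted_sqr_Amx (R : realType) n k B mu (u : 'cV[R]_n) :
  supported k u -> supported k.+1 (shifted_sqr_Amx n B mu *m u).
Proof.
move=> su; rewrite shifted_sqr_AmxE; apply: supported_lin.
  exact: supported_sqr_Amx.
exact/supportedZ/(supportedW (leqnSn k)).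
Qed.

Lemma Span_sub (R : realType) n (S V : set 'cV[R]_n) : V 0 ->
  (forall a u v, V u -> V v -> V (a *: u + v)) -> S `<=` V -> Span S `<=` V.
Proof.
move=> V0 Vlin SV _ [p [c [u [Su ->]]]].
elim: p c u Su => [|p IHp] c u Su; first by rewrite big_ord0.
by rewrite big_ord_recl; apply: Vlin; [exact: SV|apply: IHp => i; exact: Su].
Qed.

(** The [y] side is tracked after multiplication by [Amx], since [Amx] alone reverses coordinates
    and does not preserve prefixes. The induction is strong because each span draws on all earlier
    ones. *)
Lemma supported_span (R : realType) n (Bx By Lxy mux muy : R) (b : 'cV[R]_n)
    x y Hx Hy :
  supported 2 (Amx R n *m b) ->
  pure_first_order_span (hard_instance Bx By Lxy mux muy b) x y Hx Hy ->
  x 0%N = 0 -> y 0%N = 0 ->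
  forall k, Hx k `<=` supported k /\
    Hy k `<=` [set v | supported k.+1 (Amx R n *m v)].
Proof.
move=> Ab [Hx0 Hy0 HxS HyS xyH] x0 y0.
have VA k : (fun v : 'cV[R]_n => supported k (Amx R n *m v)) 0.
  by rewrite mulmx0; exact: supported0.
have VAlin k (a : R) (u v : 'cV[R]_n) : supported k (Amx R n *m u) ->
    supported k (Amx R n *m v) -> supported k (Amx R n *m (a *: u + v)).
  by move=> su sv; rewrite mulmxDr -scalemxAr; exact: supported_lin.
elim/ltn_ind => -[_|k IHk].
  rewrite Hx0 Hy0 x0 y0; split; apply: Span_sub => //.
  - exact: supported0.
  - by move=> *; exact: supported_lin.
  - by move=> _ ->; exact: supported0.
  - exact: VA.
  - by move=> a u v /=; exact: VAlin.
  - by move=> _ -> /=; exact: VA.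
rewrite HxS HyS; split; apply: Span_sub => //.
- exact: supported0.
- by move=> *; exact: supported_lin.
- move=> _ [i ik [->|[xt [yt [xtH ytH ->]]]]]; have [IHx IHy] := IHk i ik.
    by apply: supportedW (IHx _ (xyH i).1); exact: leqW.
  (* The block applied to [xt] and the coupling term in [Amx *m yt] both have support [i.+1]. *)
  rewrite hard_instanceE grad_x_bilin_saddle ?tr_shifted_sqr_Amx//.
  apply: (@supportedW _ _ i.+1) => //.
  rewrite -scalemxAl addrC; apply: supported_lin; first exact: IHy.
  exact/supported_shifted_sqr_Amx/IHx.
- exact: VA.
- by move=> a u v /=; exact: VAlin.
- move=> _ [i ik [->|[xt [yt [xtH ytH ->]]]]]; have [IHx IHy] := IHk i ik.
    by apply: supportedW (IHy _ (xyH i).2); exact: leqW.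
  (* After multiplication by [Amx] the three terms are a multiple of A^2 xt with support [i.+1], the
     block applied to A yt with support [i.+2], and A b with support 2. *)
  rewrite hard_instanceE grad_y_bilin_saddle ?tr_shifted_sqr_Amx//=.
  apply: (@supportedW _ _ i.+2) => //.
  rewrite linearZ/= tr_Amx -addrA -scalemxAl; apply: (VAlin).
    rewrite -sqr_AmxE; apply/(@supportedW _ _ i.+1) => //.
    exact/supported_sqr_Amx/IHx.
  rewrite -[- (_ *m _)]scaleN1r; apply: (VAlin); last first.
    rewrite mulmxN -scaleN1r; apply/supportedZ/(supportedW _ Ab).
    by rewrite !ltnS.
  rewrite shifted_sqr_AmxE; apply: (VAlin).
    rewrite sqr_AmxE -sqr_AmxE; exact/supported_sqr_Amx/IHy.
  rewrite -scalemxAr; apply/supportedZ/supportedW/IHy => //.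
Qed.

(** * Geometric approximation of the minimizer *)

(** With [alpha] and [beta] of the theorem this is the product of the two diagonal blocks plus
    (Lxy^2 / 4) A^2, divided by Bx By. *)
Definition reduced_mx {R : realType} n (alpha beta : R) : 'M[R]_n :=
  Amx R n ^+ 2 *m Amx R n ^+ 2 + alpha *: Amx R n ^+ 2 + beta *: 1%:M.

Lemma reduced_mxE (R : realType) n alpha beta (x : 'cV[R]_n) :
  reduced_mx n alpha beta *m x = Amx R n ^+ 2 *m (Amx R n ^+ 2 *m x)
    + alpha *: (Amx R n ^+ 2 *m x) + beta *: x.
Proof. by rewrite !mulmxDl -!scalemxAl mul1mx mulmxA. Qed.

Lemma reduced_mx_posdef (R : realType) n alpha beta (x : 'cV[R]_n) : 0 <= alpha ->
  beta * dot x x <= dot x (reduced_mx n alpha beta *m x).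
Proof.
move=> a0; rewrite reduced_mxE !dot_lin lerDr addr_ge0//.
  by rewrite dot_mul tr_sqr_Amx dot_ge0.
by rewrite mulr_ge0// dot_sqr_Amx dot_ge0.
Qed.

(** Split off [beta] times the identity: the rest is positive semidefinite, so the cross term of the
    expanded square is nonnegative. *)
Lemma reduced_mx_expand (R : realType) n alpha beta (x : 'cV[R]_n) :
  0 <= alpha -> 0 <= beta -> beta ^+ 2 * dot x x <=
    dot (reduced_mx n alpha beta *m x) (reduced_mx n alpha beta *m x).
Proof.
move=> a0 b0; have := reduced_mx_posdef 0 x a0.
have -> : reduced_mx n alpha beta *m x = reduced_mx n alpha 0 *m x + beta *: x.
  by rewrite !reduced_mxE scale0r addr0.
move: (reduced_mx _ _ _ *m x) => w; rewrite mul0r => xw.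
rewrite !dot_lin (dotC w x).
have := dot_ge0 w; have := mulr_ge0 b0 xw; lra.
Qed.

(** The exponent [i.+1] restores the 1-based x_i = q^i. *)
Definition geometric_col {R : realType} n (q : R) : 'cV[R]_n :=
  \col_(i < n) q ^+ i.+1.

(* The geometric column solves every row of the reduced system but the last
   two, where the missing terms are of order q ^+ n. *)
Lemma geometric_col_residual (R : realType) m (alpha beta q : R) :
  let n := m.+4 in
  let r := reduced_mx n alpha beta *m geometric_col n q - bhat n alpha beta q in
  1 - (4 + alpha) * q + (6 + 2 * alpha + beta) * q ^+ 2
    - (4 + alpha) * q ^+ 3 + q ^+ 4 = 0 ->
  [/\ forall i, (i < m.+2)%N -> zcoef r i = 0,
      zcoef r m.+2 = - q ^+ n.+1
    & zcoef r m.+3 = - q ^+ n * (1 - (4 + alpha) * q + q ^+ 2)].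
Proof.
move=> n r q4; set X := geometric_col n q; set T := Amx R n ^+ 2.
(* An interior row sees a full five-point stencil of powers of [q], that is, the quartic times a
   power of [q]. *)
have q4M j : q ^+ j * (1 - (4 + alpha) * q + (6 + 2 * alpha + beta) * q ^+ 2
    - (4 + alpha) * q ^+ 3 + q ^+ 4) = 0 by rewrite q4 mulr0.
have X_lt i : (i < n)%N -> zcoef X i = q ^+ i.+1.
  exact: (zcoef_col (fun i => q ^+ i.+1)).
have X_n : zcoef X m.+4 = 0 by exact: zcoef_ge.
have t0 : zcoef (T *m X) 0 = q - q ^+ 2 by rewrite zcoef_sqr_Amx0// !X_lt.
have tS i : (i.+2 < n)%N ->
    zcoef (T *m X) i.+1 = 2 * q ^+ i.+2 - q ^+ i.+1 - q ^+ i.+3.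
  by move=> ni; rewrite zcoef_sqr_AmxS ?(ltnW ni)// !X_lt ?(ltnW ni)//; lia.
have tn : zcoef (T *m X) m.+3 = 2 * q ^+ m.+4 - q ^+ m.+3.
  by rewrite zcoef_sqr_AmxS// X_n !X_lt// subr0.
have t_n : zcoef (T *m X) m.+4 = 0 by exact: zcoef_ge.
pose bh (i : nat) : R := match i with
    | 0%N => (2 + alpha + beta) * q - (3 + alpha) * q ^+ 2 + q ^+ 3
    | 1%N => q - 1
    | _ => 0 end.
have bhE i : (i < n)%N -> zcoef (bhat n alpha beta q) i = bh i.
  exact: zcoef_col.
have rE i : (i < n)%N -> zcoef r i =
    zcoef (T *m (T *m X)) i + alpha * zcoef (T *m X) i + beta * zcoef X i - bh i.
  by move=> ni; rewrite /r reduced_mxE !(zcoefD, zcoefN, zcoefZ) bhE.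
split.
(* Row 0 is an identity by the choice of the first entry of [bhat]. Row 1 is short of the quartic by
   1 - q, which the entry [q - 1] compensates. *)
- move=> [|[|i]] ni.
  + rewrite rE// zcoef_sqr_Amx0// tS// t0 X_lt//=.
    by ring.
  + rewrite rE// zcoef_sqr_AmxS// !tS// t0 X_lt//= -[RHS]q4.
    by ring.
  + rewrite rE ?zcoef_sqr_AmxS ?tS ?tS ?tS ?X_lt//=; try lia.
    rewrite -[RHS](q4M i.+1) !exprS; ring.
(* In the last two rows the residual is what truncation at [n] removes from the infinite geometric
   sequence. *)
- rewrite rE// zcoef_sqr_AmxS// tn !tS// X_lt//= -[RHS]addr0.
  rewrite -[X in _ = _ + X](q4M m.+1) !exprS; ring.
- rewrite rE// zcoef_sqr_AmxS// tn t_n !tS// X_lt//= -[RHS]addr0.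
  rewrite -[X in _ = _ + X](q4M m.+2) !exprS; ring.
Qed.

Lemma geometric_col_error (R : realType) n (alpha beta q : R) (xs : 'cV[R]_n) :
  (4 <= n)%N -> 0 < q -> q < 1 -> 0 <= alpha -> 0 <= beta ->
  1 - (4 + alpha) * q + (6 + 2 * alpha + beta) * q ^+ 2
    - (4 + alpha) * q ^+ 3 + q ^+ 4 = 0 ->
  reduced_mx n alpha beta *m xs = bhat n alpha beta q ->
  let e := xs - geometric_col n q in
  beta ^+ 2 * dot e e <= 2 * (7 + alpha) ^+ 2 * q ^+ (2 * n).
Proof.
case: n xs => [|[|[|[|m]]]]// xs _ q0 q1 a0 b0 q4 Mxs /=.
set e := xs - _.
apply: le_trans (reduced_mx_expand e a0 b0) _.
rewrite mulmxBr Mxs -opprB dotNl dotNr opprK dot_zcoef.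
have [r0 r1 r2] := geometric_col_residual m q4.
rewrite 2!big_ord_recr/= big1 ?add0r => [|i _]; last by rewrite r0 ?expr0n.
rewrite r1 r2 mulnC exprM (exprSr q m.+4); move: (q ^+ m.+4) => Q.
have qQ : q ^+ 2 * Q ^+ 2 <= Q ^+ 2.
  by rewrite ler_piMl ?sqr_ge0// expr_le1// ltW.
(* For [q] in (0, 1) the absolute value is at most 1 + (4 + alpha) + 1. *)
have c : (1 - (4 + alpha) * q + q ^+ 2) ^+ 2 <= (6 + alpha) ^+ 2.
  have h1 := mulr_ge0 a0 (ltW q0); have h2 := sqr_ge0 q.
  have h3 : q ^+ 2 <= 1 by rewrite expr_le1// ltW.
  have h4 : alpha * q <= alpha by rewrite ler_piMr// ltW.
  by rewrite -subr_ge0 subr_sqr mulr_ge0//; lra.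
have := ler_wpM2l (sqr_ge0 Q) c.
have : 0 <= Q ^+ 2 * alpha by rewrite mulr_ge0 ?sqr_ge0.
have : 0 <= Q ^+ 2 * alpha ^+ 2 by rewrite mulr_ge0 ?sqr_ge0.
have := sqr_ge0 Q.
lra.
Qed.

(** The tail is q^(2k) times the sum of the first n - k terms. The k terms missing from the full sum
    are dominated by the first k, and k <= n - k, so doubling covers them. *)
Lemma geometric_tail (R : realType) (q : R) n k : 0 < q -> q < 1 ->
  (2 * k <= n)%N ->
  q ^+ (2 * k) * (\sum_(i < n) (q ^+ i.+1) ^+ 2) <=
    2 * \sum_(i < n | (k <= i)%N) (q ^+ i.+1) ^+ 2.
Proof.
move=> q0 q1 kn; pose a i : R := (q ^+ i.+1) ^+ 2.
have a0 i : 0 <= a i by rewrite sqr_ge0.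
have aD i j : a (i + j)%N = q ^+ (2 * i) * a j.
  by rewrite /a -!exprM -exprD; congr (_ ^+ _); lia.
have aq i j : a (i + j)%N <= a j.
  by rewrite aD ler_piMl// exprn_ile1// ltW.
pose m := (n - k)%N.
have nE : n = (k + m)%N by rewrite /m; lia.
have -> : \sum_(i < n | (k <= i)%N) a i = q ^+ (2 * k) * \sum_(i < m) a i.
  rewrite -(big_mkord (fun i => (k <= i)%N)) nE (@big_cat_nat _ _ _ k)/= ?leq_addr//.
  rewrite big_nat_cond big1 ?add0r; last by move=> i; lia.
  rewrite -{1}[k]add0n big_addn addKn big_mkord mulr_sumr.
  by apply: eq_big => i; rewrite ?leq_addl// addnC aD.
rewrite mulrCA ler_wpM2l ?exprn_ge0 ?(ltW q0)// [in leLHS]nE addnC big_split_ord/=.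
rewrite mulr_natl mulr2n lerD2l.
apply: (@le_trans _ _ (\sum_(i < k) a i)); first by apply: ler_sum => i _; exact: aq.
rewrite (big_ord_widen m)//; last by rewrite /m; lia.
by rewrite big_mkcond ler_sum// => i _; case: ifP.
Qed.

(** With c = q^(2k), the distance is at least c S / 4 - |e|^2, while c |xs|^2 / 16 is at most c S /
    8 + |e|^2 / 8. This leaves 9 |e|^2 <= c S, and S >= q^2. *)
Lemma tail_dist (R : realType) n k (q : R) (xs xt : 'cV[R]_n) :
  0 < q -> q < 1 -> (0 < n)%N -> (2 * k <= n)%N -> supported k xt ->
  let e := xs - geometric_col n q in
  9 * dot e e <= q ^+ (2 * k) * q ^+ 2 ->
  q ^+ (2 * k) * (dot xs xs / 16) <= dot (xt - xs) (xt - xs).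
Proof.
move=> q0 q1 n0 kn sxt e eS.
have xhE i : (i < n)%N -> zcoef (geometric_col n q) i = q ^+ i.+1.
  exact: (zcoef_col (fun i => q ^+ i.+1)).
have xsE i : (i < n)%N -> zcoef xs i = q ^+ i.+1 + zcoef e i.
  by move=> ni; rewrite -xhE// -zcoefD /e addrC subrK.
set S := \sum_(i < n) (q ^+ i.+1) ^+ 2.
have qS : q ^+ 2 <= S.
  rewrite /S (bigD1 (Ordinal n0))//= expr1 lerDl sumr_ge0// => i _.
  exact: sqr_ge0.
have S2 := geometric_tail q0 q1 kn; rewrite -/S in S2.
have xs_le : dot xs xs <= 2 * S + 2 * dot e e.
  rewrite !dot_zcoef !mulr_sumr -big_split/=; apply: ler_sum => i _.
  rewrite xsE//; have := sqr_ge0 (q ^+ i.+1 - zcoef e i); lra.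
set T := \sum_(i < n | (k <= i)%N) (q ^+ i.+1) ^+ 2 in S2.
(* Beyond [k] the entry of [xt] is 0, and (a + e)^2 >= a^2 / 2 - e^2 because (a + 2 e)^2 >= 0. *)
have xt_ge : T / 2 - dot e e <= dot (xt - xs) (xt - xs).
  rewrite lerBlDr !dot_zcoef -big_split/= mulr_suml [X in X <= _]big_mkcond/=.
  apply: ler_sum => i _; case: ifP => [ki|_]; last by rewrite addr_ge0 ?sqr_ge0.
  rewrite zcoefD zcoefN sxt// xsE//.
  have := sqr_ge0 (q ^+ i.+1 + 2 * zcoef e i); lra.
have k1 : q ^+ (2 * k) <= 1 by rewrite exprn_ile1// ltW.
have k0 : 0 <= q ^+ (2 * k) by rewrite exprn_ge0// ltW.
move: (q ^+ (2 * k)) k0 k1 S2 eS => c c0 c1 S2 eS.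
have h1 := ler_wpM2l c0 xs_le; have h2 := ler_wpM2l c0 qS.
have h3 : c * dot e e <= dot e e by rewrite ler_piMl ?dot_ge0.
lra.
Qed.

(** * The stationary point and the choice of the dimension *)

Lemma hard_instance_stationary (R : realType) n (Bx By Lxy mux muy : R)
    (bh xs : 'cV[R]_n) :
  let alpha := Lxy ^+ 2 / (4 * Bx * By) + mux / Bx + muy / By in
  let beta := mux * muy / (Bx * By) in
  let A := Amx R n in
  let b := (2 * Bx * By / Lxy) *: (invmx A *m bh) in
  let ys := - (2 / Lxy) *: (invmx A *m (shifted_sqr_Amx n Bx mux *m xs)) in
  Bx != 0 -> By != 0 -> Lxy != 0 -> reduced_mx n alpha beta *m xs = bh ->
  shifted_sqr_Amx n Bx mux *m xs + ((Lxy / 2) *: A) *m ys = 0 /\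
  ((Lxy / 2) *: A)^T *m xs - shifted_sqr_Amx n By muy *m ys - b = 0.
Proof.
move=> alpha beta A b ys Bx0 By0 Lxy0 Mxs; have Au : A \in unitmx := Amx_unit R n.
have Ays : A *m ys = - (2 / Lxy) *: (shifted_sqr_Amx n Bx mux *m xs).
  by rewrite -scalemxAr mulKVmx.
split.
  rewrite -scalemxAl Ays scalerA (_ : _ * _ = -1) ?scaleN1r ?subrr//.
  by field.
(* [ys] solves the first equation. Multiplied by the injective [A], the second becomes 2 Bx By / Lxy
   times the reduced system, which explains the scaling of [b]. *)
apply: Amx_inj; rewrite -/A !mulmxBr linearZ/= tr_Amx -/A.
rewrite -[(_ *: A) *m xs]scalemxAl -scalemxAr -sqr_AmxE -/A.
rewrite /b -[A *m (_ *: _)]scalemxAr mulKVmx// -Mxs reduced_mxE.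
have -> : A *m (shifted_sqr_Amx n By muy *m ys) =
    shifted_sqr_Amx n By muy *m (A *m ys).
  by rewrite !shifted_sqr_AmxE !mulmxDr -!scalemxAr !sqr_AmxE.
rewrite Ays -scalemxAr !shifted_sqr_AmxE !mulmxDr -!scalemxAr -/A.
move: (A ^+ 2 *m (A ^+ 2 *m xs)) (A ^+ 2 *m xs) => tt t.
apply/matrixP => i j; rewrite !mxE /alpha /beta; field.
by rewrite Bx0 By0.
Qed.

Lemma small_power_exists (R : realType) (q X d : R) (N : nat) : 0 < q -> q < 1 ->
  0 < d -> exists n : nat, [/\ (N <= n)%N, X <= n%:R & q ^+ n <= d].
Proof.
move=> q0 q1 d0.
have /cvgr0Pnorm_le/(_ d d0) qn : q ^+ n @[n --> \oo] --> 0.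
  by apply: cvg_expr; rewrite ger0_norm// ltW.
have : \forall n \near \oo, [/\ (N <= n)%N, X <= n%:R & q ^+ n <= d].
  near=> n; split; [by near: n; exact: nbhs_infty_ge|
    by near: n; exact: nbhs_infty_ger|].
  by rewrite (le_trans (ler_norm _))//; near: n.
by move=> /filter_ex.
Unshelve. all: by end_near. Qed.

Theorem theorem4p5 (R : realType) (Lx Ly Lxy mux muy q : R)
  (mux_gt0 : 0 < mux) (muy_gt0 : 0 < muy)
  (mux_lt_Lx : mux < Lx) (muy_lt_Ly : muy < Ly) (Lxy_gt0 : 0 < Lxy) :
  let Bx := (Lx - mux) / 4 in
  let By := (Ly - muy) / 4 in
  let alpha := Lxy ^+ 2 / (4 * Bx * By) + mux / Bx + muy / By in
  let beta := mux * muy / (Bx * By) in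
  1 - (4 + alpha) * q + (6 + 2 * alpha + beta) * q ^+ 2
    - (4 + alpha) * q ^+ 3 + q ^+ 4 = 0 ->
  1 - (1 / 2 + 1 / (2 * Num.sqrt 2) *
        Num.sqrt (Lx / mux + Lxy ^+ 2 / (mux * muy) + Ly / muy))^-1 < q ->
  q < 1 - (1 / 2 + 1 / 2 *
        Num.sqrt (Lxy ^+ 2 / (mux * muy) + Lx / mux + Ly / muy - 1))^-1 ->
  forall k : nat, (0 < k)%N ->
  exists n : nat,
    let b : 'cV[R]_n :=
      (2 * Bx * By / Lxy) *: (invmx (Amx R n) *m bhat n alpha beta q) in
    let F := hard_instance Bx By Lxy mux muy b in
    [/\ Num.max (2 * log_base q ((7 + alpha) / beta)) (2 * k)%:R <= n%:R :> R,
        problem_class Lx Ly Lxy mux muy F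
      & exists xs ys : 'cV[R]_n,
        [/\ saddle_point F xs ys,
            forall xs' ys', saddle_point F xs' ys' -> xs' = xs /\ ys' = ys
          & forall (x y : nat -> 'cV[R]_n) (Hx Hy : nat -> set 'cV[R]_n),
            pure_first_order_span F x y Hx Hy -> x 0%N = 0 -> y 0%N = 0 ->
            forall xt yt : 'cV[R]_n, Hx k xt -> Hy k yt ->
              (exists M m : R,
                [/\ is_max (range (F xt)) M,
                    is_min (range (fun x' => F x' yt)) m
                  & M - m >=
                    q ^+ (2 * k) * (mux * enorm (xs - x 0%N) ^+ 2 / 32)])
              /\ enorm (xt - xs) ^+ 2 >=
                   q ^+ (2 * k) * (enorm (xs - x 0%N) ^+ 2 / 16)]].
Proof.
move=> Bx By alpha beta q4 qlb qub k k0.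
have Bx0 : 0 < Bx by rewrite divr_gt0// subr_gt0.
have By0 : 0 < By by rewrite divr_gt0// subr_gt0.
have beta0 : 0 < beta by apply: divr_gt0; apply: mulr_gt0.
have alpha0 : 0 <= alpha.
  apply: addr_ge0; last by apply: divr_ge0; exact: ltW.
  apply: addr_ge0; apply: divr_ge0; rewrite ?sqr_ge0//; try exact: ltW.
  by rewrite -mulrA; apply: mulr_ge0 => //; apply/ltW/mulr_gt0.
(* The inverse subtracted in the upper bound is nonnegative. *)
have q1 : q < 1.
  apply: lt_le_trans qub _; rewrite lerBlDr lerDl invr_ge0.
  by rewrite addr_ge0 ?mulr_ge0 ?sqrtr_ge0.
(* Both condition numbers are at least 1, so the radicand is at least 2 and the inverse subtracted
   in the lower bound is at most 1. *)
have q0 : 0 < q.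
  apply: le_lt_trans qlb; rewrite subr_ge0 invf_le1; last first.
    by rewrite ltr_pwDl// ?mulr_ge0 ?invr_ge0 ?mulr_ge0 ?sqrtr_ge0.
  set Y := _ + _ / muy.
  have Y2 : 2 <= Y.
    have : 1 <= Lx / mux by rewrite ler_pdivlMr// mul1r ltW.
    have : 1 <= Ly / muy by rewrite ler_pdivlMr// mul1r ltW.
    have : 0 <= Lxy ^+ 2 / (mux * muy).
      by rewrite divr_ge0 ?exprn_ge0 ?mulr_ge0 ?ltW.
    by rewrite /Y; lra.
  have s0 : 0 < Num.sqrt 2 :> R by rewrite sqrtr_gt0.
  have : 1 <= Num.sqrt Y / Num.sqrt 2.
    by rewrite ler_pdivlMr// mul1r ler_wsqrtr.
  rewrite (_ : 1 / (2 * _) * _ = Num.sqrt Y / Num.sqrt 2 / 2); first by lra.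
  by field; rewrite gt_eqF.
(* The factor 18 is the 9 required by [tail_dist] times the 2 in [geometric_col_error]. *)
pose d := q ^+ (2 * k) * q ^+ 2 * beta ^+ 2 / (18 * (7 + alpha) ^+ 2).
have a7 : 0 < (7 + alpha) ^+ 2 by rewrite exprn_gt0// ltr_pwDl.
have d0 : 0 < d.
  apply: divr_gt0; last exact: mulr_gt0.
  by apply: mulr_gt0; [apply: mulr_gt0|]; exact: exprn_gt0.
(* [log_base q ((7 + alpha) / beta)] is typically negative, so the required
   lower bound on [n] does not make [q ^+ n] small: [n] is taken larger. *)
have [n [nN nX nd]] := small_power_exists
  (2 * log_base q ((7 + alpha) / beta)) (maxn 4 (2 * k)) q0 q1 d0.
move: nN; rewrite geq_max => /andP[n4 n2k].
exists n; move=> b F; split.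
- by rewrite ge_max nX/= ler_nat.
- rewrite (_ : Lx = 4 * Bx + mux); last by rewrite /Bx; field.
  rewrite (_ : Ly = 4 * By + muy); last by rewrite /By; field.
  exact: problem_class_hard_instance.
have Mu : reduced_mx n alpha beta \in unitmx.
  by apply: posdef_unitmx beta0 _ => x; exact: reduced_mx_posdef.
pose xs := invmx (reduced_mx n alpha beta) *m bhat n alpha beta q.
have Mxs : reduced_mx n alpha beta *m xs = bhat n alpha beta q by rewrite mulKVmx.
have := hard_instance_stationary (lt0r_neq0 Bx0) (lt0r_neq0 By0)
  (lt0r_neq0 Lxy_gt0) Mxs.
set ys := _ *: (_ *m (_ *m xs)); rewrite -/b => -[stx sty].
have Pmu := fun x => @shifted_sqr_Amx_ge R n Bx mux x (ltW Bx0).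
have Qmu := fun x => @shifted_sqr_Amx_ge R n By muy x (ltW By0).
have PT := tr_shifted_sqr_Amx n Bx mux; have QT := tr_shifted_sqr_Amx n By muy.
exists xs, ys.
have [sad uniq] := saddle_bilin_saddle PT QT mux_gt0 muy_gt0 Pmu Qmu stx sty.
rewrite /F hard_instanceE; split=> //.
move=> x y Hx Hy; rewrite -hard_instanceE => span x0 y0 xt yt Hxt Hyt.
rewrite x0 subr0 !sqr_enorm.
(* [Amx *m b] is a multiple of [bhat], whose entries from index 2 on are 0. *)
have Ab : supported 2 (Amx R n *m b).
  rewrite -scalemxAr mulKVmx ?Amx_unit//; apply: supportedZ => -[|[|i]]// _.
  case: (ltnP i.+2 n) => ni; last exact: zcoef_ge.
  by rewrite -[X in zcoef _ X]/(val (Ordinal ni)) zcoef_ord mxE.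
have sxt := (supported_span Ab span x0 y0 k).1 _ Hxt.
have err := geometric_col_error n4 q0 q1 alpha0 (ltW beta0) q4 Mxs.
have dist : q ^+ (2 * k) * (dot xs xs / 16) <= dot (xt - xs) (xt - xs).
  apply: tail_dist => //; first exact: leq_trans n4.
  rewrite -(ler_pM2l (exprn_gt0 2 beta0)) mulrCA.
  apply: le_trans (ler_wpM2l _ err) _ => //.
  (* The error involves q^(2n), and q^(2n) <= q^n since 0 < q < 1. *)
  have qn : q ^+ (2 * n) <= d.
    apply: le_trans nd; rewrite mul2n -addnn exprD ler_piMl ?exprn_ge0 ?(ltW q0)//.
    by rewrite exprn_ile1 ?ltW.
  have a18 : 0 < 18 * (7 + alpha) ^+ 2 by exact: mulr_gt0.
  have := ler_wpM2r (ltW a18) qn; rewrite /d divfK ?gt_eqF//.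
  by lra.
split=> //; rewrite hard_instanceE.
have [M [m [HM Hm gap]]] :=
  gap_bilin_saddle xt yt PT QT mux_gt0 muy_gt0 Pmu Qmu stx sty.
exists M, m; split=> //; apply: le_trans gap.
(* Strong convexity contributes mux / 2, which turns 1 / 16 into mux / 32. *)
by have := ler_wpM2l (ltW mux_gt0) dist; lra.
Qed.
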